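(* Suppose that the law of $\max_{0\le t\le T}S_t$ under $\mathbb{Q}$ is absolutely continuous with respect to Lebesgue measure. Then for almost every $H>0$, $$\lim_{\Delta K\to0^+}\ \frac{\Delta}{\Delta K}V_{f_B}(H,K)\Big|_{K=\Delta K}=\frac{\partial}{\partial K}V_{f_{LB}}(K)\Big|_{K=H},$$ where the derivative $\frac{\partial}{\partial K}V_{f_{LB}}(K)$ on the right-hand side exists for almost every $K>0$.
   Context: $\mathbb{Q}$ is a probability (pricing) measure, the interest rate is $0$, and $V_f=\mathbb{E}_{\mathbb{Q}}f$ denotes the price of a payoff $f$. $(S_t)_{0\le t\le T}$ is a stock price process with values in $(0,\infty)$, such that $\max_{0\le t\le T}S_t$ exists a.s. and has finite $\mathbb{Q}$-expectation. The barrier call and look-back call payoffs are $$f_B(H,K)=\mathbf{1}_{\max_{0\le t\le T}S_t\ge H}\,(S_T-K)^+,\qquad f_{LB}(K)=\Big(\max_{0\le t\le T}S_t-K\Big)^+ .$$ For a function $K\mapsto V(H,K)$, $\frac{\Delta}{\Delta K}V(H,K)=\frac{V(H,K+\Delta K)-V(H,K)}{\Delta K}$ is the difference quotient with step $\Delta K>0$; in the statement it is evaluated at the base point $K=\Delta K$. *)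

(* Defs.v *)
From HB Require Import structures.
From mathcomp Require Import all_boot all_order all_algebra.
From mathcomp Require Import all_classical all_reals all_analysis.

Set Implicit Arguments.
Unset Strict Implicit.
Unset Printing Implicit Defensive.

Import Order.TTheory GRing.Theory Num.Theory.
Import numFieldNormedType.Exports.

Local Open Scope classical_set_scope.
Local Open Scope ring_scope.

Definition is_max (R : realType) (A : set R) (m : R) : Prop :=
  A m /\ ubound A m.

(* fine sends an infinite expectation to 0; the payoffs priced below are
   integrable whenever M is integrable, M >= ST > 0 a.s. and K >= 0. *)
Definition price (d : measure_display) (Omega : measurableType d)
    (R : realType) (Q : probability Omega R) (f : Omega -> R) : R :=
  fine ('E_Q[f]).

(* In the payoffs, M w is the maximum of the path of w over the whole time
   interval and ST w is the terminal value of that path. *)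
Definition barrier_call (Omega : Type) (R : realType) (M ST : Omega -> R)
    (H K : R) (w : Omega) : R :=
  \1_[set w' | H <= M w'] w * Num.max (ST w - K) 0.

Definition lookback_call (Omega : Type) (R : realType) (M : Omega -> R)
    (K : R) (w : Omega) : R :=
  Num.max (M w - K) 0.

Definition diff_quot (R : realType) (V : R -> R) (dK K : R) : R :=
  (V (K + dK) - V K) / dK.

(* Main.v *)
Require Import Defs.
From HB Require Import structures.
From mathcomp Require Import all_boot all_order all_algebra.
From mathcomp Require Import all_classical all_reals all_analysis.
From mathcomp Require Import measurable_realfun lra.

(* With (x)^+ = max x 0: as h tends to 0, the slope of k |-> (x - k)^+ between
   k and k + h tends to -1_{k <= x} for x <> k, and its slope between h and 2h
   tends to -1 for x > 0; both are bounded by 1. By dominated convergence, the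
   two limits of the theorem exist for every H and equal - Q(M >= H), because
   Q(M = H) = 0 by absolute continuity and S_T > 0. *)

Set Implicit Arguments.
Unset Strict Implicit.
Unset Printing Implicit Defensive.

Import Order.TTheory GRing.Theory Num.Theory.
Import numFieldNormedType.Exports.

Local Open Scope classical_set_scope.
Local Open Scope ring_scope.

(** This Lipschitz bound is the source of the dominating constant 1: moving the strike by [h]
    changes a call payoff by at most [|h|]. *)
Lemma normr_posB_le (R : realType) (x y : R) :
  `|Num.max x 0 - Num.max y 0| <= `|x - y|.
Proof.
rewrite ler_norml /Num.max; have := ler_norm (x - y); have := ler_norm (y - x).
rewrite (distrC y).
by case: (ltP x 0) => ?; case: (ltP y 0) => ? ? ?; apply/andP; split; lra.
Qed.

Lemma normr_slope_le1 (R : realType) (h a b : R) :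
  h != 0 -> `|a - b| <= `|h| -> `|h^-1 * (a - b)| <= 1.
Proof.
by move=> h0 ab; rewrite normrM normfV mulrC ler_pdivrMr ?normr_gt0// mul1r.
Qed.

(** When [|h|] is below the distance from [x] to [k], the strikes [k] and [h + k] lie on the same
    side of [x], where the payoff is affine in the strike; so the slope equals its limit exactly. *)
Lemma pos_slope (R : realType) (x k h : R) : h != 0 -> `|h| < `|x - k| ->
  h^-1 * (Num.max (x - (h + k)) 0 - Num.max (x - k) 0) = - (k <= x)%R%:R.
Proof.
move=> h0; rewrite ltr_norml; case: (leP k x) => kx.
  rewrite ger0_norm ?subr_ge0// => /andP[? ?].
  rewrite !max_l; [|lra..].
  by rewrite (_ : _ - _ = - h) ?mulrN ?mulVf//; lra.
rewrite ltr0_norm ?subr_lt0// => /andP[? ?].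
by rewrite !max_r ?subrr ?mulr0 ?oppr0//; lra.
Qed.

(** Domination is asked only almost everywhere because the terminal price is bounded by the maximum
    only almost surely. *)
Lemma ae_le_integrable (d : measure_display) (T : measurableType d)
    (R : realType) (mu : {measure set T -> \bar R}) (f g : T -> R) :
  measurable_fun setT f -> {ae mu, forall x, `|f x| <= `|g x|} ->
  mu.-integrable setT (EFin \o g) -> mu.-integrable setT (EFin \o f).
Proof.
move=> mf fg /integrableP[mg gfin].
have mf' : measurable_fun setT (EFin \o f) by exact/measurable_EFinP.
apply/integrableP; split => //.
apply: le_lt_trans gfin; apply: ae_ge0_le_integral => //.
- exact: measurableT_comp.
- exact: measurableT_comp.
- by apply: filterS fg => x fgx _; rewrite /= lee_fin.
Qed.

Lemma priceE (d : measure_display) (Omega : measurableType d) (R : realType)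
    (Q : probability Omega R) (f : Omega -> R) :
  price Q f = \int[Q]_w f w.
Proof. by rewrite /price unlock. Qed.

(** Dominated convergence with the constant 1, integrable since [Q] is finite. In the uses below
    [c n] is the inverse of the step; both payoffs vary with [n] because in the barrier quotient the
    base strike moves too. *)
Lemma price_slope_cvg (d : measure_display) (Omega : measurableType d)
    (R : realType) (Q : probability Omega R) (X Y : nat -> Omega -> R)
    (c : nat -> R) (G : Omega -> R) :
  (forall n, Q.-integrable setT (EFin \o X n)) ->
  (forall n, Q.-integrable setT (EFin \o Y n)) ->
  measurable_fun setT G ->
  (forall n w, `|c n * (X n w - Y n w)| <= 1) ->
  {ae Q, forall w, c n * (X n w - Y n w) @[n --> \oo] --> G w} ->
  c n * (price Q (X n) - price Q (Y n)) @[n --> \oo] --> price Q G.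
Proof.
move=> iX iY mG le1 XYG.
have iXY n : Q.-integrable setT (EFin \o (fun w => X n w - Y n w)).
  by rewrite (_ : _ \o _ = (EFin \o X n) \- (EFin \o Y n))%E//; exact: integrableB.
have -> : (fun n => c n * (price Q (X n) - price Q (Y n))) =
    (fun n => fine (\int[Q]_w (c n * (X n w - Y n w))%:E)).
  apply/funext => n; rewrite !priceE -RintegralB// -RintegralZl//.
have iC : Q.-integrable setT (EFin \o cst 1) by exact: finite_measure_integrable_cst.
have mXY n : measurable_fun setT (fun w => (c n * (X n w - Y n w))%:E).
  apply/measurable_EFinP; apply: measurable_funM => //.
  by have /integrableP[/measurable_EFinP] := iXY n.
have [||iG _ cG] := @dominated_convergence _ _ _ Q setT measurableT
  (fun n w => (c n * (X n w - Y n w))%:E) (EFin \o G) (EFin \o cst 1)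
  mXY (proj2 (measurable_EFinP _ _) mG) _ iC.
- apply: filterS XYG => w Gw _.
  by apply/fine_cvgP; split => //; exact: nearW.
- by apply: aeW => w n _; rewrite /= lee_fin.
(* The convergence is in the extended reals; integrability of [G] makes the limit finite, so [fine]
   preserves it. *)
apply: fine_cvg; rewrite priceE /Rintegral fineK//.
exact: integrable_fin_num.
Qed.

Section price_limits.
Context (d : measure_display) (Omega : measurableType d) (R : realType).
Context (Q : probability Omega R) (M : Omega -> R).
Hypothesis mM : measurable_fun setT M.
Hypothesis iM : Q.-integrable setT (EFin \o M).

(** The common limit payoff: a short position in the digital option that pays 1 if the maximum
    reaches [K]. *)
Let digital (K : R) (w : Omega) : R := - \1_[set w' | K <= M w'] w.

Lemma digitalE (K : R) (w : Omega) : digital K w = - (K <= M w)%R%:R.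
Proof. by rewrite /digital indicE mem_setE. Qed.

Lemma measurable_ge_level (K : R) : measurable [set w | K <= M w].
Proof.
rewrite (_ : mkset _ = setT `&` M @^-1` `[K, +oo[%classic); first exact: mM.
by rewrite setTI; apply/seteqP; split => w /=; rewrite in_itv/= andbT.
Qed.

Lemma measurable_digital (K : R) : measurable_fun setT (digital K).
Proof.
by apply: measurable_funN; apply: measurable_indic; exact: measurable_ge_level.
Qed.

Lemma integrable_pos (X : Omega -> R) (K : R) :
  Q.-integrable setT (EFin \o X) ->
  Q.-integrable setT (EFin \o (fun w => Num.max (X w - K) 0)).
Proof.
move=> iX; have mX : measurable_fun setT X.
  by have /integrableP[/measurable_EFinP] := iX.
have iXK : Q.-integrable setT (EFin \o (fun w => X w - K)).
  rewrite (_ : _ \o _ = (EFin \o X) \- (EFin \o cst K))%E//.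
  by apply: integrableB => //; exact: finite_measure_integrable_cst.
apply: ae_le_integrable iXK.
  by apply: measurable_maxr => //; apply: measurable_funB.
apply: aeW => w; have := normr_posB_le (X w - K) 0.
by rewrite maxxx !subr0.
Qed.

Lemma lookback_slope_cvg (K : R) : Q [set w | M w = K] = 0%E ->
  h^-1 * (price Q (lookback_call M (h + K)) - price Q (lookback_call M K))
    @[h --> 0^'] --> price Q (digital K).
Proof.
move=> MK; apply/cvgr_dnbhsP => u [u0 ucvg].
apply: price_slope_cvg.
- by move=> n; exact: integrable_pos.
- by move=> n; exact: integrable_pos.
- exact: measurable_digital.
- move=> n w; apply: normr_slope_le1 => //.
  apply: le_trans (normr_posB_le _ _) _.
  by rewrite (_ : _ - _ = - u n) ?normrN//; lra.
(* Where [M w = K] the right slope is 0 and the left slope is -1, so the pointwise two-sided limit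
   fails there; this event is the exceptional null set. *)
exists [set w | M w = K]; split => //.
  rewrite (_ : mkset _ = setT `&` M @^-1` [set K]) ?setTI//.
  by rewrite -[X in measurable X]setTI; exact: mM.
move=> w /=; apply: contra_notP => /eqP MwK.
apply: cvg_near_cst.
have MwK0 : 0 < `|M w - K| by rewrite normr_gt0 subr_eq0.
have /cvgr0Pnorm_lt/(_ _ MwK0) := ucvg.
by apply: filterS => n un; rewrite digitalE /lookback_call pos_slope.
Qed.

(** Both payoffs of the quotient carry the same indicator of [H <= M w], which factors out and
    leaves the slope of a plain call on [X] between the strikes [dK] and [dK + dK]. *)
Lemma barrier_slope_cvg (X : Omega -> R) (H : R) : measurable_fun setT X ->
  {ae Q, forall w, 0 < X w <= M w} ->
  diff_quot (fun K => price Q (barrier_call M X H K)) dK dK @[dK --> 0^'+] -->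
    price Q (digital H).
Proof.
move=> mX XM.
have iX : Q.-integrable setT (EFin \o X).
  apply: ae_le_integrable iM => //.
  apply: filterS XM => w /andP[X0 XMw].
  by rewrite !ger0_norm// ltW// (lt_le_trans X0).
have iB K : Q.-integrable setT (EFin \o barrier_call M X H K).
  apply: ae_le_integrable (integrable_pos K iX).
    apply: measurable_funM.
      by apply: measurable_indic; exact: measurable_ge_level.
    by apply: measurable_maxr => //; apply: measurable_funB.
  apply: aeW => w; rewrite /barrier_call indicE normrM.
  by case: (_ \in _); rewrite ?normr1 ?mul1r ?normr0 ?mul0r.
apply/cvg_at_rightP => u [u0 ucvg].
under eq_fun do rewrite /diff_quot mulrC.
apply: price_slope_cvg => //.
- exact: measurable_digital.
- move=> n w; apply: normr_slope_le1; first by rewrite gt_eqF.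
  rewrite /barrier_call -mulrBr normrM indicE.
  apply: (@le_trans _ _ (1 * `|u n|)); last by rewrite mul1r.
  apply: ler_pM => //; first by case: (_ \in _); rewrite ?normr1 ?normr0.
  apply: le_trans (normr_posB_le _ _) _.
  by rewrite (_ : _ - _ = - u n) ?normrN//; lra.
apply: filterS XM => w /andP[X0 _].
apply: cvg_near_cst.
(* Once [u n] is below half of [X w], the calls with strikes [u n] and [u n + u n] both end in the
   money, and their payoffs differ by exactly [- u n]. *)
have X02 : 0 < X w / 2 by lra.
have /cvgr0Pnorm_lt/(_ _ X02) := ucvg.
apply: filterS => n; have := u0 n => un0; rewrite gtr0_norm// => un.
rewrite /barrier_call -mulrBr mulrCA !max_l; [|lra..].
rewrite (_ : _ - _ - _ = - u n); last by lra.
by rewrite mulrN mulVf ?gt_eqF// mulrN1.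
Qed.

End price_limits.

Theorem theorem2p1 (d : measure_display) (Omega : measurableType d)
    (R : realType) (Q : probability Omega R)
    (T : R) (T_ge0 : 0 <= T) (S : R -> Omega -> R)
    (S_meas : forall t : R, t \in `[0, T] -> measurable_fun setT (S t))
    (S_gt0 : forall (t : R) (w : Omega), t \in `[0, T] -> 0 < S t w)
    (M : {RV Q >-> R})
    (M_max : {ae Q, forall w, is_max [set S t w | t in `[0, T]] (M w)})
    (M_int : Q.-integrable setT (EFin \o M))
    (M_ac : distribution Q M `<< @lebesgue_measure R) :
  let V_B := fun H K : R => price Q (barrier_call M (S T) H K) in
  let V_LB := fun K : R => price Q (lookback_call M K) in
  {ae @lebesgue_measure R, forall K : R, 0 < K -> derivable V_LB K 1} /\
  {ae @lebesgue_measure R, forall H : R, 0 < H ->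
     diff_quot (V_B H) dK dK @[dK --> 0^'+] --> derive1 V_LB H}.
Proof.
move=> V_B V_LB.
have mM : measurable_fun setT M by [].
have TT : T \in `[0, T] by rewrite in_itv/= T_ge0 lexx.
(* Points are Lebesgue-null, so absolute continuity of the law of [M] rules out an atom at any
   level. *)
have M_atomless K : Q [set w | M w = K] = 0%E.
  by have /null_content_dominatesP/(_ [set K] (measurable_set1 K)
    (lebesgue_measure_set1 K)) := M_ac.
have STM : {ae Q, forall w, 0 < S T w <= M w}.
  apply: filterS M_max => w [_ Mub].
  by rewrite S_gt0//; apply: Mub; exists T.
have dV K := lookback_slope_cvg mM M_int (M_atomless K).
split; apply: aeW => K _.
  rewrite /derivable.
  under eq_fun do rewrite /= scaler1.
  by apply: cvgP; exact: (dV K).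
(* [derive1] is the limit of the quotient treated in [dV]; the payoff on the right is [digital]
   unfolded, hence also the barrier limit. *)
have -> : derive1 V_LB K = price Q (fun w => - \1_[set w' | K <= M w'] w).
  by apply: cvg_lim => //; exact: (dV K).
exact: (barrier_slope_cvg mM M_int (S_meas T TT) STM).
Qed.
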